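(* Let $H$ be a finite connected undirected graph (without multiple edges) which is not bipartite. Then the hom-shift $\mathrm{Hom}(\mathbb{Z}^d,H)$ has property $F$ witnessed by a family of patterns $\mathcal{P}$ whose entropy $h(\mathcal{P})$ equals the topological entropy of $\mathrm{Hom}(\mathbb{Z}^d,H)$.
   Context: $\mathrm{Hom}(\mathbb{Z}^d,H)$ is the set of maps $x:\mathbb{Z}^d\to V(H)$ sending vertices adjacent in $\mathbb{Z}^d$ (i.e. differing by a standard unit vector) to adjacent vertices of $H$, with the shift action $(\sigma^\gamma x)_\delta=x_{\gamma+\delta}$. For a symbolic system $X$ (shift-invariant subset of $\mathcal{A}^{\mathbb{Z}^d}$), $\mathcal{L}(X,B)=\{x|_B:x\in X\}$. A $k$-grid union is a set $B=\gamma+C+[1,k]^d$ with $C\subseteq k\mathbb{Z}^d$, $\gamma\in\mathbb{Z}^d$, such that $B$ and $\mathbb{Z}^d\setminus B$ are connected. A family of patterns $\mathcal{P}=(P_C)$ indexed by $k$-grid unions, with $P_C\subseteq\mathcal{L}(X,C)$ and translation invariant (a pattern on $C$ is in $P_C$ iff its translate to $C+\alpha$ is in $P_{C+\alpha}$), has property $F$ with gap $m$ if (1) for all $k$-grid unions $C,C_1,\dots,C_r$ and $c_i\in P_{C_i}$ with the $C_j+[-m,m]^d$ pairwise disjoint and contained in $C$, there is $c\in P_C$ with $c|_{C_j}=c_j$ for all $j$; (2) any $x\in\mathcal{A}^{\mathbb{Z}^d}$ with $x|_C\in P_C$ for all $C$ in an increasing sequence of $k$-grid unions covering $\mathbb{Z}^d$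 lies in $X$. $X$ has property $F$ (witnessed by $\mathcal{P}$) if such $k,m,\mathcal{P}$ exist. The entropy of $\mathcal{P}$ is $h(\mathcal{P})=\liminf_n(nk)^{-d}\log|P_{[1,nk]^d}|$. *)

(* Defs.v *)
From Stdlib Require Import ZArith Reals.
From Coquelicot Require Import Coquelicot.
From mathcomp Require Import all_boot.
From mathcomp Require Import boolp.

Set Implicit Arguments. Unset Strict Implicit. Unset Printing Implicit Defensive.

Definition pt (d : nat) := 'I_d -> Z.

Definition peq {d} (p q : pt d) : Prop := forall i, p i = q i.

Definition adjZ {d} (p q : pt d) : Prop :=
  exists (i : 'I_d) (s : Z), (s = 1 \/ s = -1)%Z /\
    forall j, q j = (p j + (if j == i then s else 0))%Z.

Definition Hom (d : nat) (T : finType) (e : rel T) (x : pt d -> T) : Prop :=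
  forall p q : pt d, adjZ p q -> e (x p) (x q).

Definition graph_connected (T : finType) (e : rel T) : Prop :=
  forall u v : T, connect e u v.
Definition bipartite (T : finType) (e : rel T) : Prop :=
  exists c : T -> bool, forall u v, e u v -> c u != c v.

Definition in_box {d} (k : nat) (r : pt d) : Prop :=
  forall i, (1 <= r i <= Z.of_nat k)%Z.
Definition in_cube {d} (m : nat) (r : pt d) : Prop :=
  forall i, (- Z.of_nat m <= r i <= Z.of_nat m)%Z.
Definition in_kZ {d} (k : nat) (p : pt d) : Prop :=
  forall i, exists z : Z, p i = (Z.of_nat k * z)%Z.

Inductive reach {d} (S : pt d -> Prop) : pt d -> pt d -> Prop :=
| reach_refl : forall p q, peq p q -> reach S p q
| reach_step : forall p q r, reach S p q -> adjZ q r -> S r -> reach S p r.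

Definition connectedZ {d} (S : pt d -> Prop) : Prop :=
  forall p q, S p -> S q -> reach S p q.

Definition gu_set {d} (k : nat) (gamma : pt d) (C : pt d -> Prop) (p : pt d) : Prop :=
  exists c r, C c /\ in_box k r /\ forall i, p i = (gamma i + c i + r i)%Z.

Definition is_grid_union {d} (k : nat) (B : pt d -> Prop) : Prop :=
  exists (gamma : pt d) (C : pt d -> Prop),
    (forall c, C c -> in_kZ k c) /\
    (forall p, B p <-> gu_set k gamma C p) /\
    connectedZ B /\ connectedZ (fun p => ~ B p).

Definition thick {d} (m : nat) (S : pt d -> Prop) (p : pt d) : Prop :=
  exists q r, S q /\ in_cube m r /\ forall i, p i = (q i + r i)%Z.

(* Patterns on a set S are represented by total maps pt d -> T, considered
   up to agreement on S. *)
Definition agree {d} {T : Type} (S : pt d -> Prop) (x y : pt d -> T) : Prop :=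
  forall p, S p -> x p = y p.

Definition inL {d} {T : Type} (X : (pt d -> T) -> Prop) (S : pt d -> Prop)
  (c : pt d -> T) : Prop := exists x, X x /\ agree S x c.

Definition psub {d} (p a : pt d) : pt d := fun i => (p i - a i)%Z.

(* A family of patterns indexed by sets: P B c means "c|_B is in P_B". *)
Definition patfam d (T : Type) := (pt d -> Prop) -> (pt d -> T) -> Prop.

(* Coherence of the representation: P_B depends only on the set B and on
   the restriction of the pattern to B. *)
Definition family_wd {d} {T : Type} (P : patfam d T) : Prop :=
  forall B B' c c', (forall p, B p <-> B' p) -> agree B c c' -> P B c -> P B' c'.

Definition property_F_with {d} {T : Type} (X : (pt d -> T) -> Prop)
  (k m : nat) (P : patfam d T) : Prop :=
  (0 < k)%N /\
  family_wd P /\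
  (forall B c, is_grid_union k B -> P B c -> inL X B c) /\
  (forall B (a : pt d) c, is_grid_union k B ->
     (P B c <-> P (fun p => B (psub p a)) (fun p => c (psub p a)))) /\
  (forall (B : pt d -> Prop) (r : nat) (Bs : nat -> pt d -> Prop) (cs : nat -> pt d -> T),
     is_grid_union k B ->
     (forall j, (j < r)%N -> is_grid_union k (Bs j) /\ P (Bs j) (cs j)) ->
     (forall j j', (j < r)%N -> (j' < r)%N -> j <> j' ->
        forall p, ~ (thick m (Bs j) p /\ thick m (Bs j') p)) ->
     (forall j, (j < r)%N -> forall p, thick m (Bs j) p -> B p) ->
     exists c, P B c /\ forall j, (j < r)%N -> agree (Bs j) c (cs j)) /\
  (forall (Bn : nat -> pt d -> Prop) (x : pt d -> T),
     (forall n, is_grid_union k (Bn n)) ->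
     (forall n p, Bn n p -> Bn n.+1 p) ->
     (forall p, exists n, Bn n p) ->
     (forall n, P (Bn n) x) -> X x).

Definition boxset {d} (N : nat) (p : pt d) : Prop :=
  forall i, (1 <= p i <= Z.of_nat N)%Z.
Definition bx (d N : nat) := {ffun 'I_d -> 'I_N}.
Definition pt_of {d N} (f : bx d N) : pt d := fun i => Z.of_nat (f i).+1.
Definition restrict {d} {T : finType} (N : nat) (x : pt d -> T) : {ffun bx d N -> T} :=
  [ffun f => x (pt_of f)].

Definition count_box {d} {T : finType} (N : nat) (S : (pt d -> T) -> Prop) : nat :=
  #|[set r : {ffun bx d N -> T} | `[< exists c, S c /\ restrict N c = r >]]|.

Definition entropy_family {d} {T : finType} (k : nat) (P : patfam d T) : Rbar :=
  LimInf_seq (fun n => (ln (INR (count_box (n.+1 * k) (P (boxset (n.+1 * k)))))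
                        / (INR (n.+1 * k) ^ d))%R).

Definition top_entropy {d} {T : finType} (X : (pt d -> T) -> Prop) : Rbar :=
  Lim_seq (fun n => (ln (INR (count_box n.+1 X)) / (INR n.+1 ^ d))%R).

(* Main.v *)
(** Fix an edge v0 v1 of H. With k = 1, let P_B consist of the patterns on B that
    extend to a homomorphism equal to a v0/v1-checkerboard, of either phase,
    outside B. As H is connected and not bipartite, it has a walk which starts
    by alternating between v0 and v1 in one phase and ends by alternating in the
    other; reading this walk along the distance to B switches the phase outside
    B within a bounded distance, which yields the gluing property.

    For the entropy, choose by pigeonhole a boundary pattern of [0, N]^d having
    at least count / |T|^(boundary size) fillings. Reflected copies of such
    fillings tile a box of M^d cells, independently in every cell. The values on
    the boundary of this box are a folded copy of one fixed filling z of
    [0, N]^d. Outside, a point at l1-distance t from the box whose projection to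
    the box folds to v receives the value of z after t steps of a path from v to
    the origin (then of a walk in H from z 0 to v0, v1, v0, ...). Hence the
    checkerboard is reached within a distance that does not depend on M, and the
    entropy of P is at least that of the hom-shift. *)

Require Import Defs.
From Stdlib Require Import ZArith Reals Lia Lra.
From Coquelicot Require Import Coquelicot.
From mathcomp Require Import all_boot.
From mathcomp Require Import boolp zify.

Set Implicit Arguments. Unset Strict Implicit. Unset Printing Implicit Defensive.

Local Open Scope nat_scope.

(** * Walks in a graph *)

Definition walk (T : Type) (e : rel T) (w : nat -> T) : Prop :=
  forall n, e (w n) (w n.+1).

Definition prepend (T : Type) (a : T) (w : nat -> T) (n : nat) : T :=
  if n is n'.+1 then w n' else a.

Lemma walk_prepend (T : Type) (e : rel T) (a : T) (w : nat -> T) :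
  e a (w 0) -> walk e w -> walk e (prepend a w).
Proof. by move=> eaw ww [|n] //; apply: ww. Qed.

Definition alternate (T : Type) (a b : T) (n : nat) : T :=
  if odd n then b else a.

Lemma walk_alternate (T : Type) (e : rel T) (a b : T) :
  symmetric e -> e a b -> walk e (alternate a b).
Proof.
by move=> es eab n; rewrite /alternate /=; case: odd; rewrite //= es.
Qed.

Lemma connect_eventually_alternating_walk (T : finType) (e : rel T) (a b c : T) :
  symmetric e -> connect e a b -> e b c ->
  exists w s, [/\ walk e w, w 0 = a & forall n, w (s + n) = alternate b c n].
Proof.
move=> es /connectP[p]; elim: p a => [|a' p IHp] a /=.
  move=> _ <- ebc; exists (alternate b c), 0.
  by split=> //; apply: walk_alternate.
case/andP=> eaa' pp lp ebc; have [w [s [ww w0 ws]]] := IHp _ pp lp ebc.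
exists (prepend a w), s.+1; split=> //.
by apply: walk_prepend => //; rewrite w0.
Qed.

(* The bipartite double cover: a closed walk of odd length in the graph lifts to
   a path between the two copies of its base point. *)
Definition double_cover (T : finType) (e : rel T) : rel (T * bool) :=
  fun x y => e x.1 y.1 && (x.2 != y.2).

Section DoubleCover.
Variables (T : finType) (e : rel T).
Hypothesis e_sym : symmetric e.

Lemma double_cover_sym : symmetric (double_cover e).
Proof. by move=> x y; rewrite /double_cover e_sym eq_sym. Qed.

Lemma connect_double_cover_flip (u v : T) (s t : bool) :
  connect (double_cover e) (u, s) (v, t) ->
  connect (double_cover e) (u, ~~ s) (v, ~~ t).
Proof.
case/connectP=> p; elim: p u s => [|[w r] p IHp] u s /=.
  by move=> _ [-> ->].
case/andP=> euw pp lp; apply: connect_trans (IHp _ _ pp lp).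
by apply: connect1; move: euw; rewrite /double_cover /= (inj_eq negb_inj).
Qed.

Lemma connect_double_cover_lift (u v : T) (s : bool) :
  connect e u v -> exists t, connect (double_cover e) (u, s) (v, t).
Proof.
case/connectP=> p; elim: p u s => [|w p IHp] u s /=.
  by move=> _ ->; exists s.
case/andP=> euw pp lp; have [t ct] := IHp _ (~~ s) pp lp.
exists t; apply: connect_trans ct; apply: connect1.
by rewrite /double_cover /= euw; case: s.
Qed.

Lemma nonbipartite_connect_double_cover (v : T) :
  graph_connected e -> ~ bipartite e ->
  connect (double_cover e) (v, false) (v, true).
Proof.
move=> conn nonbip; apply: contrapT => not_conn; apply: nonbip.
exists (fun u => connect (double_cover e) (v, false) (u, true)) => a b eab.
apply/negP => /eqP same; case va : (connect _ _ (a, true)) in same.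
  have vb := connect_double_cover_flip (esym same).
  rewrite (sym_connect_sym double_cover_sym) /= in vb.
  apply: not_conn; apply: connect_trans vb; apply: connect_trans va _.
  by apply: connect1; rewrite /double_cover /= eab.
have [[] va'] := connect_double_cover_lift false (conn v a).
  by rewrite va' in va.
suff : connect (double_cover e) (v, false) (b, true) by rewrite -same.
by apply: connect_trans va' _; apply: connect1; rewrite /double_cover /= eab.
Qed.

Lemma double_cover_walk_parity (w : nat -> T * bool) (n : nat) :
  walk (double_cover e) w -> (w n).2 = odd n (+) (w 0).2.
Proof.
move=> ww; elim: n => [|n IHn] //=; have /andP[_] := ww n.
by rewrite IHn; case: (w n.+1).2 (odd n) (w 0).2 => [] [] [].
Qed.

Lemma nonbipartite_phase_switching_walk (u v : T) :
  graph_connected e -> ~ bipartite e -> e u v ->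
  exists w s, [/\ walk e w, w 0 = v, w 1 = u
    & forall n, s <= n -> w n = alternate u v n].
Proof.
move=> conn nonbip euv.
have loop := nonbipartite_connect_double_cover u conn nonbip.
have edge : double_cover e (u, true) (v, false) by rewrite /double_cover /= euv.
have [w [s [ww w0 ws]]] :=
  connect_eventually_alternating_walk double_cover_sym loop edge.
exists (prepend v (fun n => (w n).1)), s.+1; split=> //=.
- apply: walk_prepend => [|n]; first by rewrite w0 /= e_sym.
  by have /andP[] := ww n.
- by rewrite w0.
case=> // n; rewrite ltnS => /subnKC <-; rewrite /alternate /= ws.
have := double_cover_walk_parity (s + (n - s)) ww.
by rewrite w0 ws addbF /alternate => <-; case: odd.
Qed.

Lemma nonbipartite_edge : ~ bipartite e -> exists u v, e u v.
Proof.
move=> nonbip; apply: contrapT => no_edge; apply: nonbip.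
by exists (fun=> true) => u v euv; case: no_edge; exists u, v.
Qed.

End DoubleCover.

(** * The lattice *)

Section Lattice.
Variable d : nat.
Implicit Types (p q a : pt d) (B : pt d -> Prop).

Lemma adjZP p q :
  adjZ p q <->
  exists i, Z.abs (q i - p i) = 1%Z /\ forall j, j != i -> q j = p j.
Proof.
split=> [[i [s [s1 qE]]]|[i [qi qj]]].
  exists i; rewrite qE eqxx; split; first by lia.
  by move=> j /negbTE ji; rewrite qE ji; lia.
exists i, (q i - p i)%Z; split; first by lia.
by move=> j; case: eqVneq => [->|/qj ->]; lia.
Qed.

Lemma adjZ_sym p q : adjZ p q -> adjZ q p.
Proof.
move=> /adjZP[i [qi qj]]; apply/adjZP; exists i; split; first by lia.
by move=> j /qj ->.
Qed.

Lemma adjZ_psub p q a : adjZ p q -> adjZ (psub p a) (psub q a).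
Proof.
move=> /adjZP[i [qi qj]]; apply/adjZP; exists i; rewrite /psub.
by split=> [|j /qj ->]; first by lia.
Qed.

Lemma adjZ_coord (f : Z -> Z) p q :
  (forall z, Z.abs (f (z + 1) - f z) = 1)%Z ->
  adjZ p q -> adjZ (fun i => f (p i)) (fun i => f (q i)).
Proof.
move=> f_step /adjZP[i [qi qj]]; apply/adjZP; exists i.
split=> [|j /qj -> //].
have [->|->] : (q i = p i + 1 \/ q i = p i - 1)%Z by lia.
  exact: f_step.
by have := f_step (p i - 1)%Z; rewrite Z.sub_add; lia.
Qed.

Lemma psubK p a : psub (psub p (fun i => - a i)%Z) a = p.
Proof. by apply/funext => i; rewrite /psub; lia. Qed.

Definition l1norm p : nat := \sum_(i < d) Z.abs_nat (p i).

Definition parity p : bool := odd (l1norm p).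

Lemma odd_abs_nat (z : Z) : odd (Z.abs_nat z) = Z.odd z.
Proof.
have -> : Z.odd z = Z.odd (Z.of_nat (Z.abs_nat z)).
  by rewrite Zabs2Nat.id_abs; case: z.
elim: (Z.abs_nat z) => // n IHn.
by rewrite Nat2Z.inj_succ Z.odd_succ -Z.negb_odd -IHn.
Qed.

Lemma parity_psub p a : parity (psub p a) = parity p (+) parity a.
Proof.
rewrite /parity /l1norm !(big_morph odd oddD (erefl _)) -big_split.
apply: eq_bigr => i _; rewrite /= !odd_abs_nat Z.odd_sub.
by case: Z.odd; case: Z.odd.
Qed.

Lemma l1norm_adj p q :
  adjZ p q -> l1norm q = (l1norm p).+1 \/ l1norm p = (l1norm q).+1.
Proof.
move=> /adjZP[i [qi qj]]; pose rest r := \sum_(j | j != i) Z.abs_nat (r j).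
have l1normE r : l1norm r = Z.abs_nat (r i) + rest r.
  by rewrite /l1norm (bigD1 i).
have restE : rest q = rest p by apply: eq_bigr => j /qj ->.
by rewrite !l1normE restE; lia.
Qed.

Lemma abs_nat_le_l1norm p i : Z.abs_nat (p i) <= l1norm p.
Proof. by rewrite /l1norm (bigD1 i) //= leq_addr. Qed.

Lemma thick_widen m n B p : m <= n -> thick m B p -> thick n B p.
Proof.
move=> mn [q [r [Bq [rm pE]]]]; exists q, r; do ! split=> //.
all: by have := rm i; lia.
Qed.

Lemma subset_thick n B p : B p -> thick n B p.
Proof.
move=> Bp; exists p, (fun=> 0%Z); do ! split=> //; last by lia.
all: by lia.
Qed.

Lemma thick_adj n B p q : adjZ p q -> thick n B p -> thick n.+1 B q.
Proof.
move=> /adjZP[i [qi qj]] [b [r [Bb [rn pE]]]]; exists b, (psub q b).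
do ! split=> //; rewrite /psub; last by lia.
all: by have := rn i0; have := pE i0; have [->|/qj ->] := eqVneq i0 i; lia.
Qed.

Lemma thick_l1norm B b p : B b -> thick (l1norm (psub p b)) B p.
Proof.
move=> Bb; exists b, (psub p b); do ! split=> //; last by rewrite /psub; lia.
all: by have := abs_nat_le_l1norm (psub p b) i; lia.
Qed.

Lemma ex_thick_distance B :
  (exists b, B b) ->
  exists D : pt d -> nat, forall n p, D p <= n <-> thick n B p.
Proof.
move=> [b Bb].
have /choice[D DP] p : exists m, forall n, m <= n <-> thick n B p.
  have ex_n : exists n, `[< thick n B p >].
    by exists (l1norm (psub p b)); apply/asboolP; apply: thick_l1norm.
  case: (ex_minnP ex_n) => m /asboolP tm minm; exists m => n.
  split=> [mn|tn]; first exact: thick_widen tm.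
  by apply: minm; apply/asboolP.
by exists D => n p; apply: DP.
Qed.

(* The distance to [thick 1 B], rounded up to the parity of the point: the
   rounding turns a 1-Lipschitz function into one with increments exactly 1. *)
Lemma ex_parity_distance B : (exists b, B b) -> exists f : pt d -> nat,
  [/\ forall p, odd (f p) = parity p,
      forall p q, adjZ p q -> f q = (f p).+1 \/ f p = (f q).+1,
      forall p, thick 1 B p -> f p <= 1
    & forall m p, ~ thick m B p -> m <= f p].
Proof.
move=> /ex_thick_distance[D DP]; pose D1 p := (D p).-1.
have D_adj p q : adjZ p q -> D q <= (D p).+1.
  by move=> pq; apply/DP; apply: thick_adj pq _; apply/DP.
exists (fun p => D1 p + (odd (D1 p) != parity p)); split=> [p|p q pq|p|m p].
- by rewrite oddD oddb; case: odd; case: parity.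
- have : parity q = ~~ parity p.
    by rewrite /parity; have [->|->] := l1norm_adj pq; rewrite //= negbK.
  by have := D_adj _ _ pq; have := D_adj _ _ (adjZ_sym pq); rewrite /D1; lia.
- by move=> /DP; rewrite /D1; lia.
move=> np; have : ~ D p <= m by move=> /DP.
by rewrite /D1; lia.
Qed.

End Lattice.

(** * Constructing homomorphisms *)

Section Homomorphisms.
Variables (d : nat) (T : finType) (e : rel T).
Hypothesis e_sym : symmetric e.
Implicit Types (x y : pt d -> T) (B : pt d -> Prop).

Lemma Hom_walk (w : nat -> T) (f : pt d -> nat) : walk e w ->
  (forall p q, adjZ p q -> f q = (f p).+1 \/ f p = (f q).+1) ->
  Hom e (fun p => w (f p)).
Proof. by move=> ww f_adj p q /f_adj[] ->; rewrite // e_sym. Qed.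

Lemma Hom_psub x (a : pt d) : Hom e x -> Hom e (fun p => x (psub p a)).
Proof. by move=> hx p q pq; apply: hx; apply: adjZ_psub. Qed.

Lemma Hom_patch B x y : Hom e x -> Hom e y ->
  (forall p q, B p -> ~ B q -> adjZ p q -> x q = y q) ->
  Hom e (fun p => if `[< B p >] then x p else y p).
Proof.
move=> hx hy xy p q pq; case: asboolP => Bp; case: asboolP => Bq.
- exact: hx.
- by rewrite -(xy _ _ Bp Bq pq); apply: hx.
- by rewrite -(xy _ _ Bq Bp (adjZ_sym pq)); apply: hx.
- exact: hy.
Qed.

Lemma Hom_glue (J : Type) (I : J -> pt d -> Prop) (y : J -> pt d -> T) x :
  Hom e x -> (forall j, Hom e (y j)) ->
  (forall j p, ~ I j p -> y j p = x p) ->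
  (forall j j' p q, I j p -> I j' q -> p = q \/ adjZ p q -> j = j') ->
  exists c, [/\ Hom e c, forall j, agree (I j) c (y j)
    & forall p, (forall j, ~ I j p) -> c p = x p].
Proof.
move=> hx hy yx I_sep.
have /choice[c cP] p : exists t, (forall j, I j p -> t = y j p) /\
    ((forall j, ~ I j p) -> t = x p).
  have [[j Ijp]|nI] := pselect (exists j, I j p).
    exists (y j p); split=> [j' Ij'p|/(_ j) //].
    by rewrite (I_sep _ _ _ _ Ijp Ij'p (or_introl (erefl _))).
  by exists (x p); split=> // j Ijp; case: nI; exists j.
have cin j p : I j p -> c p = y j p by apply: (cP p).1.
have cout p : (forall j, ~ I j p) -> c p = x p by apply: (cP p).2.
have c_out_y j p : (forall j', ~ I j' p) -> c p = y j p.
  by move=> nI; rewrite cout // yx.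
exists c; split=> // p q pq.
have [[j Ijp]|nIp] := pselect (exists j, I j p); last first.
  have {}nIp j : ~ I j p by move=> Ijp; apply: nIp; exists j.
  have [[j Ijq]|nIq] := pselect (exists j, I j q).
    by rewrite (cin _ _ Ijq) (c_out_y j) //; apply: hy.
  by rewrite !cout //; [apply: hx | move=> j Ijq; apply: nIq; exists j].
have [[j' Ij'q]|nIq] := pselect (exists j, I j q).
  have jj' := I_sep _ _ _ _ Ijp Ij'q (or_intror pq); rewrite -jj' in Ij'q.
  by rewrite !(cin j) //; apply: hy.
rewrite (cin _ _ Ijp) (c_out_y j); first exact: hy.
by move=> j' Ij'q; apply: nIq; exists j'.
Qed.

Lemma Hom_exhaustion (Bn : nat -> pt d -> Prop) x :
  (forall n p, Bn n p -> Bn n.+1 p) -> (forall p, exists n, Bn n p) ->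
  (forall n, inL (Hom e) (Bn n) x) -> Hom e x.
Proof.
move=> Bn_succ cover ext p q pq.
have Bn_add n k r : Bn n r -> Bn (n + k) r.
  by elim: k => [|k IHk]; rewrite ?addn0 // addnS => /IHk; apply: Bn_succ.
have [a Ba] := cover p; have [b Bb] := cover q; have [y [hy yx]] := ext (a + b).
by rewrite -!yx; [apply: hy | rewrite addnC; apply: Bn_add | apply: Bn_add].
Qed.

End Homomorphisms.

(** * Property F for the checkerboard family *)

Section CheckerboardFamily.
Variables (d : nat) (T : finType) (e : rel T) (v0 v1 : T).
Hypotheses (e_sym : symmetric e) (e01 : e v0 v1).
Implicit Types (p a : pt d) (B : pt d -> Prop) (x y c : pt d -> T) (s : bool).

Definition checkerboard s p : T := alternate v0 v1 (s + l1norm p).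

Definition checkerboard_outside B s x : Prop :=
  forall p, ~ B p -> x p = checkerboard s p.

Definition checkerboard_family : patfam d T := fun B c =>
  exists x s, [/\ Hom e x, agree B x c & checkerboard_outside B s x].

Lemma alternate_checkerboard n s p :
  odd n = s (+) parity p -> alternate v0 v1 n = checkerboard s p.
Proof. by rewrite /checkerboard /alternate oddD oddb => ->. Qed.

Lemma checkerboard_psub s p a :
  checkerboard s (psub p a) = checkerboard (s (+) parity a) p.
Proof.
apply: alternate_checkerboard; rewrite oddD oddb -/(parity _) parity_psub.
by rewrite -addbA [parity a (+) _]addbC.
Qed.

Lemma Hom_checkerboard s : Hom e (checkerboard s).
Proof.
apply: (@Hom_walk _ _ _ e_sym (alternate v0 v1)); first exact: walk_alternate.
by move=> p q /l1norm_adj[] ->; rewrite addnS; [left | right].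
Qed.

Lemma checkerboard_phase_change : graph_connected e -> ~ bipartite e ->
  exists m, forall B x s, Hom e x -> checkerboard_outside B s x ->
  exists y, [/\ Hom e y, agree B y x & checkerboard_outside (thick m B) false y].
Proof.
move=> conn nonbip.
have [w [m [ww w0 w1 wm]]] :=
  nonbipartite_phase_switching_walk e_sym conn nonbip e01.
exists m => B x [] hx xB; last first.
  exists x; split=> // p far; apply: xB => Bp; apply: far.
  exact: subset_thick.
have [/ex_parity_distance[f [f_odd f_adj f_near f_far]]|B0] :=
  pselect (exists b, B b); last first.
  exists (checkerboard false); split=> //; first exact: Hom_checkerboard.
  by move=> p Bp; case: B0; exists p.
exists (fun p => if `[< B p >] then x p else w (f p)); split.
- apply: Hom_patch => //; first exact: Hom_walk.
  move=> p q Bp nBq pq; rewrite xB //.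
  have fq : f q <= 1 by apply: f_near; apply: thick_adj pq _; apply: subset_thick.
  have -> : w (f q) = alternate v0 v1 (f q).+1.
    by case: (f q) fq => [|[|]].
  by symmetry; apply: alternate_checkerboard; rewrite /= f_odd.
- by move=> p Bp; case: asboolP.
move=> p far; case: asboolP => [Bp|_].
  by case: far; apply: subset_thick.
by rewrite wm ?f_far //; apply: alternate_checkerboard; rewrite f_odd.
Qed.

Lemma checkerboard_family_wd : family_wd checkerboard_family.
Proof.
move=> B B' c c' BB' cc' [x [s [hx xc xs]]]; exists x, s; split=> //.
  by move=> p /BB' Bp; rewrite xc // cc'.
by move=> p nB'p; apply: xs => /BB'.
Qed.

Lemma checkerboard_family_inL B c : checkerboard_family B c -> inL (Hom e) B c.
Proof. by case=> x [s [hx xc _]]; exists x. Qed.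

Lemma checkerboard_family_psub B a c : checkerboard_family B c ->
  checkerboard_family (fun p => B (psub p a)) (fun p => c (psub p a)).
Proof.
case=> x [s [hx xc xs]]; exists (fun p => x (psub p a)), (s (+) parity a); split.
- exact: Hom_psub.
- by move=> p; apply: xc.
by move=> p /xs ->; apply: checkerboard_psub.
Qed.

Lemma checkerboard_family_translation B a c : checkerboard_family B c <->
  checkerboard_family (fun p => B (psub p a)) (fun p => c (psub p a)).
Proof.
split=> [|/(@checkerboard_family_psub _ (fun i => - a i)%Z)].
  exact: checkerboard_family_psub.
by apply: checkerboard_family_wd => p; rewrite psubK.
Qed.

Lemma checkerboard_family_glue m r B (Bs : nat -> pt d -> Prop)
    (ys : nat -> pt d -> T) :
  (forall j, j < r -> Hom e (ys j)) ->
  (forall j, j < r -> checkerboard_outside (thick m (Bs j)) false (ys j)) ->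
  (forall j j', j < r -> j' < r -> j <> j' ->
     forall p, ~ (thick m.+1 (Bs j) p /\ thick m.+1 (Bs j') p)) ->
  (forall j, j < r -> forall p, thick m.+1 (Bs j) p -> B p) ->
  exists c, checkerboard_family B c /\ forall j, j < r -> agree (Bs j) c (ys j).
Proof.
move=> hys ys_out disj sub.
have thick_sep (j j' : 'I_r) p q : thick m (Bs j) p -> thick m (Bs j') q ->
    p = q \/ adjZ p q -> j = j'.
  move=> tp tq pq; apply: val_inj; apply: contrapT => jj'.
  apply: (disj _ _ (ltn_ord j) (ltn_ord j') jj' q); split.
    by case: pq => [<-|pq]; [apply: thick_widen tp | apply: thick_adj tp].
  exact: thick_widen tq.
have [c [hc cys cout]] := @Hom_glue _ _ e 'I_r (fun j => thick m (Bs j)) ys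
  (checkerboard false) (Hom_checkerboard false) (fun j => hys j (ltn_ord j))
  (fun j => ys_out j (ltn_ord j)) thick_sep.
exists c; split; last first.
  move=> j jr p Bp; apply: (cys (Ordinal jr)).
  by apply: subset_thick.
exists c, false; split=> // p nBp; apply: cout => j tp; apply: nBp.
by apply: (sub j) => //; apply: thick_widen tp.
Qed.

Lemma checkerboard_family_property_F : graph_connected e -> ~ bipartite e ->
  exists m, property_F_with (Hom e) 1 m checkerboard_family.
Proof.
move=> conn nonbip; have [m phase] := checkerboard_phase_change conn nonbip.
exists m.+1; split=> //; split; first exact: checkerboard_family_wd.
split; first by move=> B c _; apply: checkerboard_family_inL.
split; first by move=> B a c _; apply: checkerboard_family_translation.
split=> [B r Bs cs _ Pcs disj sub|Bn x _ Bn_succ cover Px]; last first.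
  by apply: Hom_exhaustion Bn_succ cover _ => n; apply: checkerboard_family_inL.
have /choice[ys ysP] j : exists y, j < r -> [/\ Hom e y, agree (Bs j) y (cs j)
    & checkerboard_outside (thick m (Bs j)) false y].
  have [jr|/negP nj] := boolP (j < r); last by exists (cs j).
  have [_ [x [s [hx xc xs]]]] := Pcs _ jr.
  have [y [hy yx ys]] := phase _ _ _ hx xs.
  by exists y => _; split=> // p Bp; rewrite yx // xc.
have [j /ysP[]//|j /ysP[]//|c [Pc cys]] :=
  checkerboard_family_glue (ys := ys) _ _ disj sub.
exists c; split=> // j jr p Bp; have [_ ysc _] := ysP _ jr.
by rewrite (cys j) // ysc.
Qed.

End CheckerboardFamily.

(** * Contracting a homomorphism *)

Section Shrinking.
Variable d : nat.
Implicit Types (p q : pt d) (i : 'I_d) (t n : nat).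

Definition prefix_norm p n : nat := \sum_(j < d | j < n) Z.abs_nat (p j).

(* The [t]-th point of the path from [p] to the origin that brings the
   coordinates to 0 one after the other. *)
Definition shrink t p : pt d := fun i =>
  let k := Z.of_nat (t - prefix_norm p i) in
  (Z.max 0 (p i - k) + Z.min 0 (p i + k))%Z.

Definition outward i p q : Prop :=
  [/\ Z.abs (q i - p i) = 1%Z, Z.abs (q i) = (Z.abs (p i) + 1)%Z
    & forall j, j != i -> q j = p j].

Lemma outward_adjZ i p q : outward i p q -> adjZ p q.
Proof. by case=> qi _ qj; apply/adjZP; exists i. Qed.

Lemma adjZ_outward p q : adjZ p q -> exists i, outward i p q \/ outward i q p.
Proof.
move=> /adjZP[i [qi qj]]; exists i.
have [out|inw] : (Z.abs (q i) = Z.abs (p i) + 1 \/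
                  Z.abs (p i) = Z.abs (q i) + 1)%Z by lia.
  by left.
by right; split=> [||j /qj]; first by lia.
Qed.

Lemma prefix_norm0 p : prefix_norm p 0 = 0.
Proof. exact: big_pred0. Qed.

Lemma prefix_norm_full p : prefix_norm p d = l1norm p.
Proof. by apply: eq_bigl => j; rewrite ltn_ord. Qed.

Lemma prefix_normS p i : prefix_norm p i.+1 = prefix_norm p i + Z.abs_nat (p i).
Proof.
rewrite /prefix_norm (bigD1 i) //= addnC; congr (_ + _).
by apply: eq_bigl => j; rewrite ltnS -val_eqE /=; case: ltngtP.
Qed.

Lemma leq_prefix_norm p : {homo prefix_norm p : m n / m <= n}.
Proof.
move=> m n mn; rewrite /prefix_norm [leqLHS]big_mkcond [leqRHS]big_mkcond.
apply: leq_sum => j _; case: ifP => // jm.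
by rewrite (leq_trans jm mn).
Qed.

Lemma prefix_norm_outward i p q n :
  outward i p q -> prefix_norm q n = prefix_norm p n + (i < n).
Proof.
case=> _ qi qj; have [lt_in|le_ni] := ltnP i n; last first.
  rewrite addn0; apply: eq_bigr => j jn; rewrite qj // -val_eqE /=.
  by move: jn le_ni; case: ltngtP; lia.
pose rest r := \sum_(j < d | (j < n) && (j != i)) Z.abs_nat (r j).
have prefixE r : prefix_norm r n = Z.abs_nat (r i) + rest r.
  by rewrite /prefix_norm (bigD1 i).
have restE : rest q = rest p by apply: eq_bigr => j /andP[_ /qj ->].
by rewrite !prefixE restE; lia.
Qed.

Lemma l1norm_outward i p q : outward i p q -> l1norm q = (l1norm p).+1.
Proof.
move=> out; rewrite -!prefix_norm_full (prefix_norm_outward _ out).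
by rewrite ltn_ord addn1.
Qed.

Lemma prefix_normS_le_l1norm p i : prefix_norm p i.+1 <= l1norm p.
Proof. by rewrite -prefix_norm_full; apply: leq_prefix_norm; apply: ltn_ord. Qed.

Lemma shrink0 p : shrink 0 p = p.
Proof. by apply/funext => i; rewrite /shrink sub0n; lia. Qed.

Lemma shrink_to_origin t p : l1norm p <= t -> shrink t p = (fun=> 0%Z).
Proof.
move=> norm_le; apply/funext => i; rewrite /shrink.
by have := prefix_normS_le_l1norm p i; rewrite prefix_normS; lia.
Qed.

Lemma shrink_outward t i p q : outward i p q -> t <= prefix_norm p i.+1 ->
  outward i (shrink t p) (shrink t q).
Proof.
move=> out; case: (out) => qi1 qi qj; rewrite prefix_normS => t_le.
have prefix_i : prefix_norm q i = prefix_norm p i.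
  by rewrite (prefix_norm_outward _ out) ltnn addn0.
split=> [||j ji]; rewrite /shrink ?prefix_i; [lia | lia |].
rewrite qj // (prefix_norm_outward _ out).
have [ij|_] := ltnP i j; last by rewrite addn0.
have := leq_prefix_norm p ij; rewrite prefix_normS.
by move=> ?; congr (_ + _)%Z; lia.
Qed.

Lemma shrink_outward_delay t i p q : outward i p q -> prefix_norm p i.+1 < t ->
  shrink t q = shrink t.-1 p.
Proof.
move=> out; case: (out) => _ qi qj; rewrite prefix_normS => t_gt.
apply/funext => j; rewrite /shrink (prefix_norm_outward _ out).
have [->|ji] := eqVneq j i; first by rewrite ltnn; lia.
rewrite qj //; have [ij|] := ltnP i j; first by congr (_ + _)%Z; lia.
rewrite leq_eqVlt val_eqE (negbTE ji) /= => ltji.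
by have := leq_prefix_norm p ltji; rewrite prefix_normS; lia.
Qed.

Lemma ex_prefix_norm_crossing t p : t < l1norm p ->
  exists i : 'I_d, prefix_norm p i <= t < prefix_norm p i.+1.
Proof.
rewrite -prefix_norm_full => t_lt.
have ex_n : exists n, t < prefix_norm p n by exists d.
case: (ex_minnP ex_n) => -[|m]; first by rewrite prefix_norm0.
move=> m_gt m_min; exists (Ordinal (m_min _ t_lt)); rewrite m_gt andbT leqNgt.
by apply/negP => /m_min; rewrite ltnn.
Qed.

Lemma shrinkS t p :
  t < l1norm p -> exists i, outward i (shrink t.+1 p) (shrink t p).
Proof.
case/ex_prefix_norm_crossing => i; rewrite prefix_normS => ti; exists i.
split=> [||j ji]; rewrite /shrink; [lia | lia |].
have [ij|] := ltnP i j.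
  have := leq_prefix_norm p ij; rewrite prefix_normS.
  by move=> ?; congr (_ + _)%Z; lia.
rewrite leq_eqVlt val_eqE (negbTE ji) /= => ltji.
by have := leq_prefix_norm p ltji; rewrite prefix_normS; lia.
Qed.

End Shrinking.

Section Contraction.
Variables (d : nat) (T : finType) (e : rel T).
Hypothesis e_sym : symmetric e.
Variables (z : pt d -> T) (w : nat -> T).
Hypotheses (z_hom : Hom e z) (ww : walk e w) (w0 : w 0 = z (fun=> 0%Z)).

(* A homotopy from [z] to constants: [z] is read along the path from [p] to the
   origin, then [w] takes over. *)
Definition contract (t : nat) (p : pt d) : T :=
  if t < l1norm p then z (shrink t p) else w (t - l1norm p).

Lemma contract_walk t p : l1norm p <= t -> contract t p = w (t - l1norm p).
Proof. by rewrite /contract ltnNge => ->. Qed.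

Lemma contract_shrink t p : t <= l1norm p -> contract t p = z (shrink t p).
Proof.
rewrite leq_eqVlt /contract => /orP[/eqP tE|->] //.
by rewrite tE ltnn subnn w0 shrink_to_origin.
Qed.

Lemma contract0 p : contract 0 p = z p.
Proof. by rewrite contract_shrink ?shrink0. Qed.

Lemma contractS t p : e (contract t p) (contract t.+1 p).
Proof.
have [t_lt|t_ge] := ltnP t (l1norm p); last first.
  by rewrite !contract_walk ?subSn //; lia.
rewrite !contract_shrink //; last by lia.
by have [i /outward_adjZ/adjZ_sym] := shrinkS t_lt; apply: z_hom.
Qed.

Lemma contract_outward t i p q :
  outward i p q -> e (contract t p) (contract t q).
Proof.
move=> out; have norm_q := l1norm_outward out.
have le_norm := prefix_normS_le_l1norm p i.
have [t_le|t_gt] := leqP t (prefix_norm p i.+1).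
  rewrite !contract_shrink ?norm_q; try lia.
  by apply: z_hom; apply: outward_adjZ (shrink_outward out t_le).
have -> : contract t q = contract t.-1 p.
  rewrite /contract norm_q (shrink_outward_delay out t_gt).
  by case: t t_gt => // t _; rewrite ltnS subSS.
by case: t t_gt => // t _; rewrite e_sym contractS.
Qed.

Lemma contract_adj t p q : adjZ p q -> e (contract t p) (contract t q).
Proof.
move=> /adjZ_outward[i [] out]; last rewrite e_sym.
all: exact: contract_outward out.
Qed.

End Contraction.

(** * Reflected tilings *)

Section Folding.
Variable N : nat.

(* Reflecting the odd cells makes patterns on [0, N]^d with a common boundary
   fit together along the faces of the cells. *)
Definition fold (z : Z) : Z :=
  (if Z.even (z / Z.of_nat N) then z mod Z.of_nat N
   else Z.of_nat N - z mod Z.of_nat N)%Z.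

Definition unfold (c z : Z) : Z :=
  (Z.of_nat N * c + (if Z.even c then z else Z.of_nat N - z))%Z.

Definition in_cell (c z : Z) : Prop :=
  (Z.of_nat N * c <= z <= Z.of_nat N * (c + 1))%Z.

Lemma unfold_in_cell c z : (0 <= z <= Z.of_nat N)%Z -> in_cell c (unfold c z).
Proof. by rewrite /in_cell /unfold; case: Z.even; lia. Qed.

Hypothesis N_gt0 : 0 < N.

Lemma in_cell_div z : in_cell (z / Z.of_nat N) z.
Proof.
have := Z.mod_pos_bound z (Z.of_nat N) ltac:(lia).
have := Z.div_mod z (Z.of_nat N) ltac:(lia).
by rewrite /in_cell; lia.
Qed.

Lemma in_cell_div_succ z : in_cell (z / Z.of_nat N) (z + 1).
Proof.
have := Z.mod_pos_bound z (Z.of_nat N) ltac:(lia).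
have := Z.div_mod z (Z.of_nat N) ltac:(lia).
by rewrite /in_cell; lia.
Qed.

Lemma in_cell_other c z : in_cell c z -> (z / Z.of_nat N)%Z <> c ->
  z = (Z.of_nat N * (c + 1))%Z.
Proof.
rewrite /in_cell => zc ne; apply: contrapT => nz; apply: ne; symmetry.
by apply: (Z.div_unique _ _ _ (z - Z.of_nat N * c)); lia.
Qed.

Lemma fold_in_cell c z : in_cell c z ->
  fold z = (if Z.even c then z - Z.of_nat N * c
            else Z.of_nat N * (c + 1) - z)%Z.
Proof.
move=> zc; rewrite /fold.
have := Z.div_mod z (Z.of_nat N) ltac:(lia).
have [->|/(in_cell_other zc) ->] := pselect (z / Z.of_nat N = c)%Z.
  by case: Z.even; lia.
rewrite Z.mul_comm Z.div_mul ?Z.mod_mul ?Z.even_add; try lia.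
by case: Z.even => /=; lia.
Qed.

Lemma fold_bound z : (0 <= fold z <= Z.of_nat N)%Z.
Proof.
have zc := in_cell_div z; rewrite (fold_in_cell zc); move: zc; rewrite /in_cell.
by case: Z.even; lia.
Qed.

Lemma fold_step z : (Z.abs (fold (z + 1) - fold z) = 1)%Z.
Proof.
rewrite (fold_in_cell (in_cell_div z)) (fold_in_cell (in_cell_div_succ z)).
by case: Z.even; lia.
Qed.

Lemma fold_mul c :
  fold (Z.of_nat N * c) = 0%Z \/ fold (Z.of_nat N * c) = Z.of_nat N.
Proof.
rewrite (@fold_in_cell c) /in_cell; last by lia.
by case: Z.even; [left | right]; lia.
Qed.

Lemma unfoldK c z : (0 <= z <= Z.of_nat N)%Z -> fold (unfold c z) = z.
Proof.
move=> zN; rewrite (fold_in_cell (unfold_in_cell c zN)) /unfold.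
by case: Z.even; lia.
Qed.

Lemma odd_fold z : Z.odd (fold z) = Z.odd z.
Proof.
rewrite (fold_in_cell (in_cell_div z)); set c := (z / _)%Z.
rewrite -[Z.even c]negbK Z.negb_even.
by case: ifP; rewrite Z.odd_sub Z.odd_mul ?Z.odd_add; case: (Z.odd c) => //=;
  case: Z.odd; case: Z.odd.
Qed.

End Folding.

Section Blocks.
Variable d : nat.
Implicit Types (p q : pt d) (l : Z).

Definition in_block l p : Prop := forall i, (0 <= p i <= l)%Z.

Definition on_block_boundary l p : Prop :=
  in_block l p /\ exists i, p i = 0%Z \/ p i = l.

Definition clamp l p : pt d := fun i => Z.max 0 (Z.min (p i) l).

Lemma l1norm_in_block n p : in_block (Z.of_nat n) p -> l1norm p <= d * n.
Proof.
move=> pn; rewrite -[d in d * n]card_ord -sum_nat_const; apply: leq_sum => i _.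
by have := pn i; lia.
Qed.

Lemma block_frontier l p q :
  in_block l p -> ~ in_block l q -> adjZ p q -> on_block_boundary l p.
Proof.
move=> pl ql /adjZP[i [qi qj]]; split=> //; exists i.
apply: contrapT => ni; apply: ql => j; have [->|/qj -> //] := eqVneq j i.
by have := pl i; lia.
Qed.

Lemma clamp_in_block l p : in_block l p -> clamp l p = p.
Proof. by move=> pl; apply/funext => i; have := pl i; rewrite /clamp; lia. Qed.

Lemma clamp_adj l p q : (0 <= l)%Z -> adjZ p q ->
  adjZ (clamp l p) (clamp l q) /\ psub p (clamp l p) = psub q (clamp l q) \/
  clamp l p = clamp l q /\ adjZ (psub p (clamp l p)) (psub q (clamp l q)).
Proof.
move=> l_ge0 /adjZP[i [qi qj]].
have same j : j != i -> clamp l q j = clamp l p j.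
  by move=> /qj; rewrite /clamp => ->.
have [ci|ci] := pselect (clamp l p i = clamp l q i); [right|left]; split.
- by apply/funext => j; have [->|/same ->] := eqVneq j i.
- apply/adjZP; exists i; split=> [|j ji]; rewrite /psub; first by lia.
  by rewrite same ?qj.
- by apply/adjZP; exists i; split=> //; move: ci; rewrite /clamp; lia.
apply/funext => j; rewrite /psub; have [->|ji] := eqVneq j i.
  by move: ci; rewrite /clamp; lia.
by rewrite same ?qj.
Qed.

End Blocks.

Section PointFolding.
Variables d N : nat.
Hypothesis N_gt0 : 0 < N.
Implicit Types p q c : pt d.

Definition fold_pt p : pt d := fun i => fold N (p i).
Definition unfold_pt c p : pt d := fun i => unfold N (c i) (p i).
Definition cell p : pt d := fun i => (p i / Z.of_nat N)%Z.

Lemma fold_pt_adj p q : adjZ p q -> adjZ (fold_pt p) (fold_pt q).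
Proof. by apply: adjZ_coord; apply: fold_step. Qed.

Lemma adjZ_common_cell p q : adjZ p q ->
  exists c : pt d, forall i, in_cell N (c i) (p i) /\ in_cell N (c i) (q i).
Proof.
move=> /adjZP[k [qk qj]].
have [qE|pE] : (q k = p k + 1 \/ p k = q k + 1)%Z by lia.
  exists (cell p) => i; split; first exact: in_cell_div.
  by have [->|/qj ->] := eqVneq i k; [rewrite qE; apply: in_cell_div_succ
                                    | apply: in_cell_div].
exists (cell q) => i; split; last exact: in_cell_div.
by have [->|/qj <-] := eqVneq i k; [rewrite pE; apply: in_cell_div_succ
                                  | apply: in_cell_div].
Qed.

Lemma fold_pt_in_block p : in_block (Z.of_nat N) (fold_pt p).
Proof. by move=> i; apply: fold_bound. Qed.

Lemma fold_pt_boundary M p : on_block_boundary (Z.of_nat (N * M)) p ->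
  on_block_boundary (Z.of_nat N) (fold_pt p).
Proof.
move=> [_ [i pi]]; split; first exact: fold_pt_in_block.
exists i; rewrite /fold_pt; have [b ->] : exists b, p i = (Z.of_nat N * b)%Z.
  by case: pi => ->; [exists 0%Z | exists (Z.of_nat M)]; lia.
exact: fold_mul.
Qed.

Lemma parity_fold_pt p : parity (fold_pt p) = parity p.
Proof.
rewrite /parity /l1norm !(big_morph odd oddD (erefl _)).
by apply: eq_bigr => i _; rewrite !odd_abs_nat odd_fold.
Qed.

End PointFolding.

Section Tiling.
Variables (d : nat) (T : finType) (e : rel T).
Hypothesis e_sym : symmetric e.
Variables N M : nat.
Hypothesis N_gt0 : 0 < N.
Implicit Types p q c : pt d.

Let L := Z.of_nat (N * M).

Variables (z : pt d -> T) (w : nat -> T) (fill : pt d -> pt d -> T).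
Hypotheses (z_hom : Hom e z) (ww : walk e w) (w0 : w 0 = z (fun=> 0%Z))
  (fill_hom : forall c, Hom e (fill c))
  (fill_boundary : forall c p, on_block_boundary (Z.of_nat N) p -> fill c p = z p).

Definition inner_tiling p : T := fill (cell N p) (fold_pt N p).

Definition outer_tiling p : T :=
  contract z w (l1norm (psub p (clamp L p))) (fold_pt N (clamp L p)).

Definition tiling p : T :=
  if `[< ~ in_block L p >] then outer_tiling p else inner_tiling p.

Lemma inner_tiling_in_cell c p :
  (forall i, in_cell N (c i) (p i)) -> inner_tiling p = fill c (fold_pt N p).
Proof.
move=> pc; rewrite /inner_tiling.
have [/funext -> //|/existsNP[i ni]] := pselect (forall i, cell N p i = c i).
rewrite !fill_boundary //; split; try exact: fold_pt_in_block.
all: exists i; rewrite /fold_pt (in_cell_other N_gt0 (pc i) ni).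
all: exact: fold_mul.
Qed.

Lemma Hom_inner_tiling : Hom e inner_tiling.
Proof.
move=> p q pq; have [c pqc] := adjZ_common_cell N_gt0 pq.
rewrite !(@inner_tiling_in_cell c) => [|i|i]; try by have [] := pqc i.
by apply: fill_hom; apply: fold_pt_adj.
Qed.

Lemma Hom_outer_tiling : Hom e outer_tiling.
Proof.
have L_ge0 : (0 <= L)%Z by rewrite /L; lia.
move=> p q /(clamp_adj L_ge0); rewrite /outer_tiling.
move=> [[pq ->]|[-> /l1norm_adj[] ->]].
- by apply: contract_adj => //; apply: fold_pt_adj.
- exact: contractS.
- by rewrite e_sym; apply: contractS.
Qed.

Lemma outer_tiling_in_block p : in_block L p -> outer_tiling p = z (fold_pt N p).
Proof.
move=> /clamp_in_block pE; rewrite /outer_tiling pE.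
have -> : l1norm (psub p p) = 0.
  by apply: big1 => i _; rewrite /psub Z.sub_diag.
exact: contract0.
Qed.

Lemma Hom_tiling : Hom e tiling.
Proof.
apply: Hom_patch => //; [exact: Hom_outer_tiling | exact: Hom_inner_tiling |].
move=> q p qL /contrapT pL /adjZ_sym pq.
rewrite outer_tiling_in_block // /inner_tiling fill_boundary //.
by apply: (@fold_pt_boundary _ _ _ M) => //; apply: block_frontier pq.
Qed.

Lemma tiling_unfold c p : (forall i, 0 <= c i < Z.of_nat M)%Z ->
  in_block (Z.of_nat N) p -> tiling (unfold_pt N c p) = fill c p.
Proof.
move=> cM pN; have in_c i := unfold_in_cell (c i) (pN i).
rewrite /tiling; case: asboolP => [[i]|_].
  by have := in_c i; have := cM i; rewrite /in_cell /L /unfold_pt; nia.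
rewrite (inner_tiling_in_cell in_c); congr fill.
by apply/funext => i; apply: unfoldK.
Qed.

Variables (v0 v1 : T) (s : nat).
Hypothesis w_eventually : forall n, w (s + n) = alternate v0 v1 n.

Lemma tiling_far p :
  (exists i, p i < - Z.of_nat (d * N + s) \/ L + Z.of_nat (d * N + s) < p i)%Z ->
  tiling p = checkerboard v0 v1 (odd s) p.
Proof.
move=> [i far]; rewrite /tiling; case: asboolP => [_|/contrapT pL]; last first.
  by have := pL i; lia.
have t_ge : d * N + s <= l1norm (psub p (clamp L p)).
  apply: leq_trans (abs_nat_le_l1norm _ i).
  by rewrite /psub /clamp; lia.
have norm_le := l1norm_in_block (fold_pt_in_block N_gt0 (clamp L p)).
rewrite /outer_tiling contract_walk; last by lia.
set t := l1norm (psub p _) in t_ge *; set v := l1norm _ in norm_le *.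
have -> : t - v = s + (t - v - s) by lia.
rewrite w_eventually; apply: alternate_checkerboard.
rewrite !oddB; try lia.
rewrite -/(parity _) -[odd v]/(parity _) (parity_fold_pt N_gt0) parity_psub.
by case: (parity p); case: (parity _); case: odd.
Qed.

End Tiling.

(** * Counting patterns *)

Lemma pigeonhole_fiber (X Y : finType) (A : {set X}) (g : X -> Y) (a : X) :
  a \in A ->
  exists2 b, b \in A & #|A| <= #|Y| * #|[set x in A | g x == g b]|.
Proof.
move=> aA; pose F b := #|[set x in A | g x == g b]|.
case: (arg_maxnP (P := mem A) F aA) => b bA b_max; exists b => //.
rewrite -sum1_card (partition_big g predT) //= -sum_nat_const.
apply: leq_sum => y _; rewrite sum1dep_card.
have [x /andP[xA /eqP <-]|fiber0] := pickP [pred x | (x \in A) && (g x == y)].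
  exact: b_max.
by rewrite (eq_card0 (A := [set _ | _])) // => x; rewrite inE; apply: fiber0.
Qed.

Lemma pigeonhole_restriction (X T : finType) (A : {set {ffun X -> T}})
    (D : {set X}) (a : {ffun X -> T}) : a \in A ->
  exists2 b, b \in A
    & #|A| <= #|T| ^ #|D| * #|[set r in A | [forall f in D, r f == b f]]|.
Proof.
move=> aA; pose res (r : {ffun X -> T}) : {ffun {f | f \in D} -> T} :=
  [ffun f => r (val f)].
have [b bA cardA] := pigeonhole_fiber res aA; exists b => //.
apply: leq_trans cardA _; rewrite card_ffun card_sig leq_mul2l.
apply/orP; right; apply: subset_leq_card; apply/subsetP => r.
rewrite !inE => /andP[-> /eqP/ffunP res_eq]; apply/forall_inP => f fD.
by have := res_eq (exist _ f fD); rewrite !ffunE /= => ->.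
Qed.

Definition boundary (d N : nat) : {set bx d N.+1} :=
  [set f : bx d N.+1 | [exists i, (f i == 0 :> nat) || (f i == N :> nat)]].

Lemma card_boundary (d N : nat) :
  0 < N -> #|boundary d N| = N.+1 ^ d - N.-1 ^ d.
Proof.
move=> N_gt0; pose interior := [pred x : 'I_N.+1 | 0 < x < N].
have card_interior : #|interior| = N.-1.
  have := cardC interior; rewrite card_ord.
  rewrite (@eq_card _ [predC interior] (pred2 ord0 ord_max)) => [|x].
    rewrite card2 -val_eqE /= eq_sym -lt0n N_gt0 addn2.
    by move=> /(congr1 (fun n => n.-2)).
  by rewrite !inE -!val_eqE /=; have := ltn_ord x; lia.
rewrite -[N.-1]card_interior -[in RHS](card_ord d) -card_ffun_on.
rewrite -[in N.+1 ^ _](card_ord N.+1) -card_ffun -(cardsC (boundary d N)).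
suff -> : #|~: boundary d N| = #|ffun_on interior : {pred bx d N.+1}|.
  by rewrite addnK.
apply: eq_card => f; rewrite !inE negb_exists.
by apply: eq_forallb => i; rewrite inE /=; case: (f i) => x /=; lia.
Qed.

Section Languages.
Variables (d : nat) (T : finType).
Implicit Types (p : pt d) (x y : pt d -> T).

Definition language N (X : (pt d -> T) -> Prop) : {set {ffun bx d N -> T}} :=
  [set r | `[< exists c, X c /\ restrict N c = r >]].

Definition coord_pt N (f : bx d N) : pt d := fun i => Z.of_nat (f i).

Lemma coord_pt_bound N (f : bx d N) i : (0 <= coord_pt f i < Z.of_nat N)%Z.
Proof. by rewrite /coord_pt; case: (f i) => k /=; lia. Qed.

Lemma ex_coord_pt N p :
  (forall i, 0 <= p i < Z.of_nat N)%Z -> exists f : bx d N, coord_pt f = p.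
Proof.
move=> pN; have lt i : Z.to_nat (p i) < N by have := pN i; lia.
exists [ffun i => Ordinal (lt i)]; apply/funext => i.
by rewrite /coord_pt ffunE /= Z2Nat.id //; have := pN i; lia.
Qed.

Lemma pt_of_coord_pt N (f : bx d N) : coord_pt f = psub (pt_of f) (fun=> 1%Z).
Proof. by apply/funext => i; rewrite /coord_pt /psub /pt_of; lia. Qed.

Lemma boxset_pt_of N p : boxset N p <-> exists f : bx d N, p = pt_of f.
Proof.
split=> [pN|[f ->] i]; last by have := ltn_ord (f i); rewrite /pt_of; lia.
have [i|f fE] := @ex_coord_pt N (psub p (fun=> 1%Z)).
  by have := pN i; rewrite /psub; lia.
exists f; apply/funext => i; have := congr1 (fun q => q i) fE.
by rewrite pt_of_coord_pt /psub; lia.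
Qed.

Lemma eq_restrictP N x y : restrict N x = restrict N y <-> agree (boxset N) x y.
Proof.
split=> [/ffunP xy p /boxset_pt_of[f ->]|xy].
  by have := xy f; rewrite !ffunE.
by apply/ffunP => f; rewrite !ffunE; apply: xy; apply/boxset_pt_of; exists f.
Qed.

Lemma count_box_inL N (P X : (pt d -> T) -> Prop) :
  (forall c, P c -> inL X (boxset N) c) -> count_box N P <= count_box N X.
Proof.
move=> PX; apply: subset_leq_card; apply/subsetP => r.
rewrite !inE => /asboolP[c [/PX[x [Xx xc]] <-]].
by apply/asboolP; exists x; split=> //; apply/eq_restrictP.
Qed.

Lemma count_box_gt0 N (X : (pt d -> T) -> Prop) x : X x -> 0 < count_box N X.
Proof.
move=> Xx; apply/card_gt0P; exists (restrict N x).
by rewrite inE; apply/asboolP; exists x.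
Qed.

Lemma count_box_le N (X : (pt d -> T) -> Prop) : count_box N X <= #|T| ^ (N ^ d).
Proof. by apply: leq_trans (max_card _) _; rewrite !card_ffun !card_ord. Qed.

Lemma language_Hom_lift (e : rel T) N (r : {ffun bx d N -> T}) :
  r \in language N (Hom e) ->
  exists x, Hom e x /\ forall f, x (coord_pt f) = r f.
Proof.
rewrite inE => /asboolP[x [hx <-]]; exists (fun p => x (psub p (fun=> -1)%Z)).
split=> [|f]; first exact: Hom_psub.
rewrite ffunE; congr x; apply/funext => i.
by rewrite pt_of_coord_pt /psub; lia.
Qed.

End Languages.

Section TilingCount.
Variables (d : nat) (T : finType) (e : rel T) (v0 v1 : T).
Hypothesis e_sym : symmetric e.
Variables N M s : nat.
Let pattern := {ffun bx d N.+1 -> T}.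
Let cells := {ffun bx d M.+1 -> pattern}.
Let margin := d * N + s.
Variables (C : {set pattern}) (r0 : pattern) (lift : pattern -> pt d -> T).
Variable w : nat -> T.
Hypotheses (N_gt0 : 0 < N) (r0C : r0 \in C)
  (C_boundary : forall (r : pattern) f,
     r \in C -> f \in boundary d N -> r f = r0 f)
  (lift_hom : forall r, r \in C -> Hom e (lift r))
  (lift_coord : forall (r : pattern) f, r \in C -> lift r (coord_pt f) = r f)
  (ww : walk e w) (w0 : w 0 = lift r0 (fun=> 0%Z))
  (w_eventually : forall n, w (s + n) = alternate v0 v1 n).
Implicit Type g : cells.

Definition cell_index (c : pt d) : bx d M.+1 :=
  [ffun i => inord (Z.to_nat (c i))].

Definition block_tiling g : pt d -> T :=
  tiling N M.+1 (lift r0) w (fun c => lift (g (cell_index c))).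

Definition placed_tiling g (p : pt d) : T :=
  block_tiling g (psub p (fun=> Z.of_nat margin.+1)).

Lemma coord_ptK : cancel (@coord_pt d M.+1) cell_index.
Proof. by move=> f; apply/ffunP => i; rewrite ffunE /coord_pt Nat2Z.id inord_val. Qed.

Lemma lift_boundary r p : r \in C ->
  on_block_boundary (Z.of_nat N) p -> lift r p = lift r0 p.
Proof.
move=> rC [pN [i pi]]; have [j|f fE] := @ex_coord_pt d N.+1 p.
  by have := pN j; lia.
rewrite -fE !lift_coord // C_boundary // inE; apply/existsP; exists i.
by move: pi; rewrite -fE /coord_pt; lia.
Qed.

Lemma placed_tiling_family g n : g \in ffun_on C ->
  2 * margin + 1 + M.+1 * N <= n ->
  checkerboard_family e v0 v1 (boxset n) (placed_tiling g).
Proof.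
move=> /ffun_onP gC n_ge.
exists (placed_tiling g), (odd s (+) parity (fun _ : 'I_d => Z.of_nat margin.+1)).
split=> //.
  apply: Hom_psub; apply: Hom_tiling => //; first exact: lift_hom.
  - by move=> c; apply: lift_hom.
  - by move=> c p; apply: lift_boundary.
move=> p /existsNP[i out]; rewrite -checkerboard_psub.
apply: tiling_far => //.
by exists i; rewrite /psub -/margin; lia.
Qed.

Lemma placed_tiling_inj n : 2 * margin + 1 + M.+1 * N <= n ->
  {in ffun_on C &, injective (fun g => restrict n (placed_tiling g))}.
Proof.
move=> n_ge g g' /ffun_onP gC /ffun_onP g'C /eq_restrictP eq_tiling.
apply/ffunP => c; apply/ffunP => f.
pose q := unfold_pt N (coord_pt c) (coord_pt f).
have fN : in_block (Z.of_nat N) (coord_pt f).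
  by move=> i; have := coord_pt_bound f i; lia.
have readoff (h : cells) : (forall c', h c' \in C) -> block_tiling h q = h c f.
  move=> hC; rewrite /block_tiling /q tiling_unfold //.
  - by rewrite coord_ptK lift_coord.
  - by move=> c' p; apply: lift_boundary.
  exact: coord_pt_bound.
rewrite -!readoff //.
have := eq_tiling (psub q (fun=> - Z.of_nat margin.+1)%Z).
rewrite /placed_tiling psubK; apply=> i; rewrite /psub.
have := unfold_in_cell (coord_pt c i) (fN i); have := coord_pt_bound c i.
by rewrite /q /unfold_pt /in_cell; nia.
Qed.

Lemma card_placed_tilings n : 2 * margin + 1 + M.+1 * N <= n ->
  #|C| ^ (M.+1 ^ d) <= count_box n (@checkerboard_family d T e v0 v1 (boxset n)).
Proof.
move=> n_ge; have <- : #|ffun_on C : {pred cells}| = #|C| ^ (M.+1 ^ d).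
  by rewrite card_ffun_on card_ffun !card_ord.
rewrite -(card_in_imset (placed_tiling_inj n_ge)).
apply: subset_leq_card; apply/subsetP => r /imsetP[g gC ->].
rewrite inE; apply/asboolP; exists (placed_tiling g).
by split=> //; apply: placed_tiling_family.
Qed.

End TilingCount.

Lemma count_checkerboard_family_ge (d : nat) (T : finType) (e : rel T)
    (v0 v1 : T) (N : nat) :
  symmetric e -> graph_connected e -> e v0 v1 -> 0 < N ->
  exists B R, count_box N.+1 (@Hom d T e) <= #|T| ^ (N.+1 ^ d - N.-1 ^ d) * B /\
    forall M n, R + M.+1 * N <= n ->
      B ^ (M.+1 ^ d) <= count_box n (@checkerboard_family d T e v0 v1 (boxset n)).
Proof.
move=> e_sym conn e01 N_gt0.
pose A : {set {ffun bx d N.+1 -> T}} := language N.+1 (Hom e).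
have /card_gt0P[a aA] : 0 < #|A|.
  exact: count_box_gt0 (Hom_checkerboard e_sym e01 false).
have [r0 r0A cardA] := pigeonhole_restriction (boundary d N) aA.
set C := [set r in A | _] in cardA.
have r0C : r0 \in C by rewrite inE r0A; apply/forall_inP.
have C_boundary (r : {ffun bx d N.+1 -> T}) f :
    r \in C -> f \in boundary d N -> r f = r0 f.
  by rewrite inE => /andP[_ /forall_inP r_eq] /r_eq/eqP.
have /choice[lift liftP] r : exists x, r \in C ->
    Hom e x /\ forall f : bx d N.+1, x (coord_pt f) = r f.
  have [/setIdP[/language_Hom_lift[x xP] _]|_] := boolP (r \in C).
    by exists x.
  by exists (fun=> v0).
have [w [s [ww w0 w_eventually]]] :=
  connect_eventually_alternating_walk e_sym (conn (lift r0 (fun=> 0%Z)) v0) e01.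
exists #|C|, (2 * (d * N + s) + 1); split=> [|M n n_ge].
  by rewrite -card_boundary.
apply: (card_placed_tilings e_sym N_gt0 r0C C_boundary _ _ ww w0 w_eventually n_ge).
  by move=> r /liftP[].
by move=> r f /liftP[].
Qed.

(** * Entropy *)

Section EntropyLimits.
Local Open Scope R_scope.

(* The standard library extends [ln] by [0] to nonpositive reals. *)
Lemma ln_0 : ln 0 = 0.
Proof. by rewrite /ln; case: Rlt_dec => // h; case: (Rlt_irrefl _ h). Qed.

Lemma ln_INR_ge0 (m : nat) : 0 <= ln (INR m).
Proof.
case: m => [|m]; first by rewrite ln_0; lra.
rewrite -ln_1; apply: ln_le; first lra.
by rewrite S_INR; have := pos_INR m; lra.
Qed.

Lemma ln_INR_le (m n : nat) : (m <= n)%N -> ln (INR m) <= ln (INR n).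
Proof.
move=> /leP mn; case: m mn => [|m] mn.
  by rewrite ln_0; apply: ln_INR_ge0.
by apply: ln_le; [apply: lt_0_INR; lia | apply: le_INR].
Qed.

Lemma INR_expn (m n : nat) : INR (m ^ n)%N = INR m ^ n.
Proof. by elim: n => [|n IHn] //; rewrite expnS mult_INR IHn. Qed.

Lemma ln_INR_expn (m n : nat) :
  (0 < m)%N -> ln (INR (m ^ n)%N) = INR n * ln (INR m).
Proof.
by move=> /ltP m_gt0; rewrite INR_expn ln_pow //; apply: lt_0_INR.
Qed.

Lemma ln_INR_mul (m n : nat) :
  (0 < m)%N -> (0 < n)%N -> ln (INR (m * n)%N) = ln (INR m) + ln (INR n).
Proof.
by move=> /ltP m_gt0 /ltP n_gt0; rewrite mult_INR ln_mult //; apply: lt_0_INR.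
Qed.

Lemma is_lim_seq_inv_succ : is_lim_seq (fun n => / INR n.+1) 0.
Proof.
apply: (is_lim_seq_inv _ p_infty) => //.
by apply/(is_lim_seq_incr_1 INR); apply: is_lim_seq_INR.
Qed.

Lemma is_lim_seq_pow_const (u : nat -> R) (l : R) (d : nat) :
  is_lim_seq u l -> is_lim_seq (fun n => u n ^ d) (l ^ d).
Proof.
apply: (is_lim_seq_continuous (fun x => x ^ d)).
by apply: derivable_continuous_pt; apply: derivable_pt_pow.
Qed.

Lemma is_lim_seq_affine_inv_succ (a b : R) :
  is_lim_seq (fun n => a - b * / INR n.+1) a.
Proof.
have -> : Rbar.Finite a = a - b * 0 by congr Rbar.Finite; ring.
apply: is_lim_seq_minus'; first exact: is_lim_seq_const.
exact: (is_lim_seq_scal_l _ b 0 is_lim_seq_inv_succ).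
Qed.

Lemma is_lim_seq_quotient (N r : nat) : (0 < N)%N ->
  is_lim_seq (fun n => INR ((n.+1 - r) %/ N) / INR n.+1) (/ INR N).
Proof.
move=> N_gt0; have INR_N_gt0 : 0 < INR N by apply: lt_0_INR; apply/ltP.
apply: (is_lim_seq_le_le
  (fun n => / INR N - (INR r / INR N + 1) * / INR n.+1) _ (fun=> / INR N));
  last first.
- exact: is_lim_seq_const.
- exact: is_lim_seq_affine_inv_succ.
move=> n; have n_gt0 : 0 < INR n.+1 by apply: lt_0_INR; lia.
set q := (_ %/ _)%N.
have q_le : INR q * INR N <= INR n.+1.
  rewrite -mult_INR; apply: le_INR; apply/leP.
  by apply: leq_trans (leq_divM _ _) _; lia.
have q_ge : INR n.+1 <= INR q * INR N + INR N + INR r.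
  rewrite -mult_INR -!plus_INR; apply: le_INR; apply/leP.
  by have := ltn_ceil (n.+1 - r) N_gt0; rewrite -/q; nia.
have -> : / INR N - (INR r / INR N + 1) * / INR n.+1 =
    (INR n.+1 - INR r - INR N) / (INR N * INR n.+1) by field; lra.
have -> : INR q / INR n.+1 = (INR q * INR N) / (INR N * INR n.+1) by field; lra.
have -> : / INR N = INR n.+1 / (INR N * INR n.+1) by field; lra.
have inv_ge0 : 0 <= / (INR N * INR n.+1).
  by apply: Rlt_le; apply: Rinv_0_lt_compat; apply: Rmult_lt_0_compat.
by split; apply: Rmult_le_compat_r => //; lra.
Qed.

Lemma is_lim_LimInf_eq (u : nat -> R) (l : Rbar) :
  is_lim_seq u l -> LimInf_seq u = l.
Proof. by move=> /is_lim_LimInf_seq /is_LimInf_seq_unique. Qed.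

Lemma is_lim_LimSup_eq (u : nat -> R) (l : Rbar) :
  is_lim_seq u l -> LimSup_seq u = l.
Proof. by move=> /is_lim_LimSup_seq /is_LimSup_seq_unique. Qed.

Lemma LimInf_seq_eq_Lim_seq (a b : nat -> R) :
  (forall n, a n <= b n) -> Rbar_le (LimSup_seq b) (LimInf_seq a) ->
  LimInf_seq a = Lim_seq b.
Proof.
move=> ab sup_le; have ab_inf : Rbar_le (LimInf_seq a) (LimInf_seq b).
  by apply: LimInf_le; exists 0%N.
have inf_sup := LimSup_LimInf_seq_le b.
have -> : LimInf_seq a = LimSup_seq b.
  by apply: Rbar_le_antisym => //; apply: Rbar_le_trans ab_inf inf_sup.
have infE : LimInf_seq b = LimSup_seq b.
  by apply: Rbar_le_antisym => //; apply: Rbar_le_trans sup_le ab_inf.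
rewrite /Lim_seq infE; case: (LimSup_seq b) => [l| |] //=.
by congr Rbar.Finite; lra.
Qed.

Lemma LimInf_seq_finite (a : nat -> R) (m M : R) :
  (forall n, m <= a n <= M) -> exists l : R, LimInf_seq a = l.
Proof.
move=> a_bounds; have m_le : Rbar_le m (LimInf_seq a).
  rewrite -(LimInf_seq_const m); apply: LimInf_le; exists 0%N => n _.
  by case: (a_bounds n).
have le_M : Rbar_le (LimInf_seq a) M.
  rewrite -(LimInf_seq_const M); apply: LimInf_le; exists 0%N => n _.
  by case: (a_bounds n).
by case: (LimInf_seq a) m_le le_M => [l| |] //; exists l.
Qed.

(* [c n] is meant to count patterns on a box of side [n.+1], not [n]. *)
Definition count_rate (d : nat) (c : nat -> nat) (n : nat) : R :=
  ln (INR (c n)) / INR n.+1 ^ d.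

Lemma INR_succ_pow_gt0 (n d : nat) : 0 < INR n.+1 ^ d.
Proof. by apply: pow_lt; apply: lt_0_INR; lia. Qed.

Lemma count_rate_bounds (d tau : nat) (c : nat -> nat) (n : nat) :
  (0 < tau)%N -> (c n <= tau ^ (n.+1 ^ d))%N ->
  0 <= count_rate d c n <= ln (INR tau).
Proof.
move=> tau_gt0 c_le; have pow_gt0 := INR_succ_pow_gt0 n d; split.
  apply: Rmult_le_pos; first exact: ln_INR_ge0.
  by apply: Rlt_le; apply: Rinv_0_lt_compat.
apply/Rle_div_l => //; rewrite -INR_expn Rmult_comm -ln_INR_expn //.
exact: ln_INR_le.
Qed.

Lemma count_rate_le (d : nat) (c h : nat -> nat) (n : nat) :
  (c n <= h n)%N -> count_rate d c n <= count_rate d h n.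
Proof.
move=> ch; apply: Rmult_le_compat_r; last exact: ln_INR_le.
by apply: Rlt_le; apply: Rinv_0_lt_compat; apply: INR_succ_pow_gt0.
Qed.

Lemma LimInf_count_rate_ge (d N r B : nat) (c : nat -> nat) :
  (0 < N)%N -> (0 < B)%N ->
  (forall M n, r + M.+1 * N <= n.+1 -> B ^ (M.+1 ^ d) <= c n)%N ->
  Rbar_le (ln (INR B) / INR N ^ d) (LimInf_seq (count_rate d c)).
Proof.
move=> N_gt0 B_gt0 B_le.
pose mu n := INR ((n.+1 - r) %/ N) / INR n.+1.
have lim : is_lim_seq (fun n => mu n ^ d * ln (INR B))
    (Rbar_mult ((/ INR N) ^ d) (ln (INR B))).
  apply: is_lim_seq_scal_r; apply: is_lim_seq_pow_const.
  exact: is_lim_seq_quotient.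
have -> : Rbar.Finite (ln (INR B) / INR N ^ d) =
    Rbar_mult ((/ INR N) ^ d) (ln (INR B)).
  by rewrite /= pow_inv Rmult_comm.
rewrite -(is_lim_LimInf_eq lim); apply: LimInf_le.
exists (r + N)%N => n /leP n_ge.
have := B_le ((n.+1 - r) %/ N).-1 n.
rewrite prednK; last by rewrite divn_gt0 //; lia.
set q := (_ %/ _)%N; have := leq_divM (n.+1 - r) N; rewrite -/q => qN.
move=> /(_ ltac:(lia)) /ln_INR_le; rewrite ln_INR_expn // INR_expn => q_le.
have -> : mu n ^ d * ln (INR B) = (INR q ^ d * ln (INR B)) / INR n.+1 ^ d.
  by rewrite /mu -/q /Rdiv Rpow_mult_distr pow_inv; ring.
apply: Rmult_le_compat_r => //.
by apply: Rlt_le; apply: Rinv_0_lt_compat; apply: INR_succ_pow_gt0.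
Qed.

(* [(n + 1) ^ d - (n - 1) ^ d] is the number of boundary points of [0, n]^d. *)
Lemma LimSup_rate_le (d : nat) (beta : nat -> R) (l t : R) :
  (forall n, (0 < n)%N ->
     beta n <= l * INR n ^ d + t * (INR n.+1 ^ d - INR n.-1 ^ d)) ->
  Rbar_le (LimSup_seq (fun n => beta n / INR n.+1 ^ d)) l.
Proof.
move=> beta_le; pose ratio k n := (1 - k * / INR n.+1) ^ d.
have ratio_lim k : is_lim_seq (ratio k) 1.
  rewrite -(pow1 d); apply: is_lim_seq_pow_const.
  exact: is_lim_seq_affine_inv_succ.
have ratioE k n : ratio k n * INR n.+1 ^ d = (INR n.+1 - k) ^ d.
  rewrite /ratio -Rpow_mult_distr; congr (_ ^ _); field.
  by have := pos_INR n; rewrite S_INR; lra.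
have lim : is_lim_seq (fun n => l * ratio 1 n + t * (1 - ratio 2 n)) l.
  have -> : Rbar.Finite l = l * 1 + t * (1 - 1) by congr Rbar.Finite; ring.
  apply: is_lim_seq_plus'; apply: is_lim_seq_mult'; try exact: is_lim_seq_const.
    exact: ratio_lim.
  by apply: is_lim_seq_minus' => //; apply: is_lim_seq_const.
rewrite -(is_lim_LimSup_eq lim); apply: LimSup_le; exists 1%N => n /leP n_gt0.
apply/Rle_div_l; first exact: INR_succ_pow_gt0.
have -> : (l * ratio 1 n + t * (1 - ratio 2 n)) * INR n.+1 ^ d =
    l * (ratio 1 n * INR n.+1 ^ d) +
    t * (INR n.+1 ^ d - ratio 2 n * INR n.+1 ^ d).
  by ring.
rewrite !ratioE; have := beta_le n n_gt0.
have -> : INR n.+1 - 1 = INR n by rewrite S_INR; ring.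
by have -> : INR n.+1 - 2 = INR n.-1 by rewrite -(prednK n_gt0) !S_INR /=; ring.
Qed.

Lemma LimInf_count_rate_eq_Lim (d tau : nat) (c h : nat -> nat) :
  (0 < tau)%N -> (forall n, 0 < h n <= tau ^ (n.+1 ^ d))%N ->
  (forall n, c n <= h n)%N ->
  (forall N, 0 < N -> exists B r,
     h N <= tau ^ (N.+1 ^ d - N.-1 ^ d) * B /\
     forall M n, r + M.+1 * N <= n.+1 -> B ^ (M.+1 ^ d) <= c n)%N ->
  LimInf_seq (count_rate d c) = Lim_seq (count_rate d h).
Proof.
move=> tau_gt0 h_bounds ch blocks.
apply: LimInf_seq_eq_Lim_seq => [n|]; first exact: count_rate_le.
have [n|l limE] := @LimInf_seq_finite (count_rate d c) 0 (ln (INR tau)).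
  apply: count_rate_bounds => //; apply: leq_trans (ch n) _.
  by case/andP: (h_bounds n).
rewrite limE; apply: (LimSup_rate_le (t := ln (INR tau))) => N N_gt0.
have [B [r [h_le B_le]]] := blocks N N_gt0; have /andP[h_gt0 _] := h_bounds N.
have /andP[pow_gt0 B_gt0] : (0 < tau ^ (N.+1 ^ d - N.-1 ^ d))%N && (0 < B)%N.
  by rewrite -muln_gt0; apply: leq_trans h_le.
have pow_le : (N.-1 ^ d <= N.+1 ^ d)%coq_nat.
  by apply/leP; have [->|d_gt0] := posnP d; rewrite ?expn0 // leq_exp2r //; lia.
have N_pow_gt0 : 0 < INR N ^ d by apply: pow_lt; apply: lt_0_INR; apply/ltP.
have ln_B_le : ln (INR B) <= l * INR N ^ d.
  apply/(Rle_div_l _ _ _ N_pow_gt0).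
  by have := LimInf_count_rate_ge N_gt0 B_gt0 B_le; rewrite limE.
have := ln_INR_le h_le.
rewrite ln_INR_mul // ln_INR_expn // minus_INR // !INR_expn.
by lra.
Qed.

End EntropyLimits.

Lemma entropy_checkerboard_family (d : nat) (T : finType) (e : rel T)
    (v0 v1 : T) :
  symmetric e -> graph_connected e -> e v0 v1 ->
  entropy_family 1 (@checkerboard_family d T e v0 v1) = top_entropy (@Hom d T e).
Proof.
move=> e_sym conn e01; rewrite /entropy_family /top_entropy.
under [X in LimInf_seq X]eq_fun do rewrite muln1.
pose family_count n :=
  count_box n.+1 (@checkerboard_family d T e v0 v1 (boxset n.+1)).
pose hom_count n := count_box n.+1 (@Hom d T e).
apply: (@LimInf_count_rate_eq_Lim d #|T| family_count hom_count) => [|n|n|N N_gt0].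
- by apply/card_gt0P; exists v0.
- rewrite count_box_le andbT.
  exact: count_box_gt0 (Hom_checkerboard e_sym e01 false).
- by apply: count_box_inL => x; apply: checkerboard_family_inL.
have [B [r [B_ge B_le]]] := count_checkerboard_family_ge d e_sym conn e01 N_gt0.
by exists B, r; split=> // M n; apply: B_le.
Qed.

Theorem theorem10p1 (d : nat) (T : finType) (e : rel T) :
  (0 < d)%N ->
  symmetric e ->
  graph_connected e ->
  ~ bipartite e ->
  exists (k m : nat) (P : patfam d T),
    property_F_with (@Hom d T e) k m P /\
    entropy_family k P = top_entropy (@Hom d T e).
Proof.
move=> _ e_sym conn nonbip; have [v0 [v1 e01]] := nonbipartite_edge nonbip.
have [m prop_F] := checkerboard_family_property_F d e_sym e01 conn nonbip.
exists 1, m, (checkerboard_family e v0 v1); split=> //.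
exact: entropy_checkerboard_family.
Qed.
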